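(* Let $n\ge 10$ be an integer. Then $$\omega(G(\mathcal{C}_n(3)))=\lfloor (n-1)^2/4\rfloor .$$ Moreover, if $n\ge 11$ is odd, then $T_2(n)$ is the unique maximum clique in $G(\mathcal{C}_n(3))$ up to permutation similarity; if $n\ge 12$ is even, then $K$ is a maximum clique in $G(\mathcal{C}_n(3))$ if and only if $K$ or $K^{-1}$ is isomorphic to $T_2(n)$. Here $$T_2(n)=\{(i,j,n): 1\le i\le \lfloor n/2\rfloor,\ \lfloor n/2\rfloor+1\le j\le n-1\}.$$
   Context: $\mathrm{Sym}(n)$ is the symmetric group on $[n]=\{1,\dots,n\}$; permutations are multiplied right-to-left. A cycle $(i_1,\dots,i_k)$ of length $k>1$ is the permutation sending $i_j$ to $i_{j+1}$ for $1\le j\le k-1$, sending $i_k$ to $i_1$, and fixing all other elements of $[n]$; in particular the identity is not a cycle. The Birkhoff polytope graph $G(\Omega_n)$ has vertex set $\mathrm{Sym}(n)$, and $\sigma_1,\sigma_2$ are adjacent iff $\sigma_1^{-1}\sigma_2$ is a (single) cycle of length $>1$. $\mathcal{C}_n(k)$ is the set of all cycles of length $k$ in $\mathrm{Sym}(n)$, and $G(\mathcal{C}_n(k))$ is the subgraph of $G(\Omega_n)$ induced by $\mathcal{C}_n(k)$. A clique is a set of pairwise adjacent vertices; $\omega(G)$ is the maximum size of a clique in $G$, and a maximum clique is one of that size. For $K\subseteq \mathrm{Sym}(n)$, $K^{-1}=\{\alpha^{-1}:\alpha\in K\}$. Two subsets $K,L\subseteq\mathrm{Sym}(n)$ are isomorphic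 (equivalently, equal up to permutation similarity) if $L=\pi K\pi^{-1}$ for some $\pi\in \mathrm{Sym}(n)$, i.e. they differ by a relabeling of $[n]$. *)

(* Defs.v *)
From mathcomp Require Import all_boot all_fingroup.

Set Implicit Arguments.
Unset Strict Implicit.
Unset Printing Implicit Defensive.

Local Open Scope group_scope.

Section Cycles.
Variable T : finType.

(* s is the cycle (c_1, ..., c_k) with k > 1: [next c] sends each entry of c to
   the following one, the last entry to the first, and fixes points outside c. *)
Definition is_cycle_on (c : seq T) (s : {perm T}) : bool :=
  [&& 1 < size c, uniq c & [forall x, s x == next c x]].

Definition is_kcycle (k : nat) (s : {perm T}) : bool :=
  [exists c : k.-tuple T, is_cycle_on c s].

(* The bound on the length is harmless: a duplicate-free sequence over T has at
   most #|T| entries. *)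
Definition is_cycle (s : {perm T}) : bool :=
  [exists k : 'I_(#|T|.+1), is_kcycle k s].

End Cycles.

(* The product of {perm T} acts left to right, (s * t) x = t (s x), so the
   right-to-left product s1^-1 s2, namely x |-> s1^-1 (s2 x), is s2 * s1^-1. *)
Definition birkhoff_adj (n : nat) : rel 'S_n :=
  fun s1 s2 => is_cycle (s2 * s1^-1).

Definition kcycles (n k : nat) : {set 'S_n} := [set s | is_kcycle k s].

(* Here a graph is an adjacency relation e together with a vertex set
   V; (V, e) is the subgraph induced by V of the graph of e on the whole type. *)
Section Cliques.
Variables (T : finType) (V : {set T}) (e : rel T).

Definition is_clique (K : {set T}) : bool :=
  (K \subset V) && [forall x in K, forall y in K, (x != y) ==> e x y].

Definition clique_number : nat := \max_(K : {set T} | is_clique K) #|K|.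

Definition is_max_clique (K : {set T}) : bool :=
  is_clique K && (#|K| == clique_number).

End Cliques.

(* [K :^ p] consists of the s ^ p = p^-1 * s * p (left to right), which is the
   right-to-left conjugate p s p^-1. *)
Definition perm_isomorphic (n : nat) (K L : {set 'S_n}) : Prop :=
  exists p : 'S_n, L = K :^ p.

(* The 3-cycles (i, j, n) with i <= n/2 < j <= n-1, where the element l of
   {1, ..., n} is represented by the ordinal l - 1. *)
Definition T2 (n : nat) : {set 'S_n} :=
  [set s : 'S_n | [exists i : 'I_n, exists j : 'I_n, exists m : 'I_n,
    [&& i < n./2, n./2 <= j, j < n.-1, m == n.-1 :> nat
      & is_cycle_on [:: i; j; m] s]]].

(* Main.v *)
Require Import Defs.
From mathcomp Require Import all_boot all_fingroup.
From mathcomp Require Import zify.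

(** A permutation is a 3-cycle exactly when it moves three points, and two
    distinct 3-cycles s, t are adjacent exactly when they move a common point and
    never run through a pair of points in opposite directions (t (s x) = x with
    s x <> x), unless t = s^-1 ([cycle_compatible], [compatible_cycle]): the
    product t s^-1 is a 5-cycle if they share one point, a 3-cycle if they share
    a directed pair or are inverse to each other, and otherwise a product of two
    disjoint cycles.  So a clique is an intersecting family of oriented triples
    with a coherence condition on pairs; this is [clique3].

    Let n be the number of points.  The main tool is [codegree]: if all members
    of a clique move v and w, and their third points lie in N, there are at most
    max(2, |N|) of them, because either they all go from v to w, or all from w to
    v, or the clique is contained in a pair {s, s^-1}.

    Suppose first that all members move a point v, and send v to its image under
    s the arc (s v, s (s v)).  By coherence a point is the source or the sink
    of arcs but not both, except for points on an isolated pair of opposite arcs.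
    If S, R are the sets of sources and sinks, the clique has at most
    |S & R| + |S - R| |R - S| members ([card_star_le]), which is at most
    floor((n-1)^2/4), and equality forces S, R to be disjoint and to split the
    other n-1 points as evenly as possible.  Such a clique is T_2(n) up to
    relabelling if |S| = floor(n/2), and its inverse is if |R| = floor(n/2).

    If there is no such v, the clique has at most 3n-10 members
    ([card_nonstar]), as in the Hilton-Milner theorem; this is at most
    floor((n-1)^2/4), with strict inequality for n >= 11.
    - If every member moves a or b, for some points a and b, let A and B be the
      members that fix b and a respectively; both are nonempty.  A point fixed by
      some member is moved by at most 3(n-4) members ([degree_le]), which settles
      the case in which A or B has at most two members.  Otherwise, if the members
      of A share a second point c, then so do those of B, every member moves two
      of a, b, c, and there are at most 2n of them ([card_two_of_three]).  The
      same holds with A and B exchanged.  If neither A nor B has a second common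
      point, each has at most four members ([card_fixing_le4]), and at most n-2
      members move both a and b.
    - If every two points are fixed by some member, then every point is moved by
      at most 7 members ([degree_uncovered]), and the three points of a single
      member already give |F| <= 1 + 3 * 6 = 19. *)

Set Implicit Arguments.
Unset Strict Implicit.
Unset Printing Implicit Defensive.

(** * Permutations moving three points *)

Section ThreeCycles.
Variable T : finType.
Implicit Types (s t : {perm T}) (x y z : T).

(** Locked, so that [inE] does not unfold membership into [s x != x]. *)
Definition moved s : {set T} := locked [set x | s x != x].

Lemma movedE s x : (x \in moved s) = (s x != x).
Proof. by rewrite /moved -lock inE. Qed.

Lemma fixedE s x : x \notin moved s -> s x = x.
Proof. by rewrite movedE negbK => /eqP. Qed.

Lemma moved_perm s x : (s x \in moved s) = (x \in moved s).
Proof. by rewrite !movedE (inj_eq perm_inj). Qed.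

Lemma moved3_orbit s x : #|moved s| = 3 -> x \in moved s ->
  [/\ uniq [:: x; s x; s (s x)], s (s (s x)) = x
    & moved s = [set x; s x; s (s x)]].
Proof.
move=> cs xs; have sxs : s x \in moved s by rewrite moved_perm.
have ssxs : s (s x) \in moved s by rewrite moved_perm.
have nsx : s x != x by move: xs; rewrite movedE.
have nssx : s (s x) != s x by move: sxs; rewrite movedE.
have n3 : s (s x) != x.
  apply/negP => /eqP e.
  have sub2 : [set x; s x] \subset moved s by rewrite subUset !sub1set xs.
  have : moved s :\: [set x; s x] != set0.
    rewrite -card_gt0; have := cardsID [set x; s x] (moved s).
    by rewrite (setIidPr sub2) cards2 eq_sym nsx cs; lia.
  case/set0Pn=> z; rewrite !inE movedE negb_or -andbA => /and3P[zx zsx zs].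
  have zsz : s z \in moved s by rewrite moved_perm movedE.
  have := subset_leq_card (_ : [set x; s x; z; s z] \subset moved s).
  rewrite !subUset !sub1set xs sxs zsz movedE zs => /(_ isT).
  have -> : [set x; s x; z; s z] = s z |: (z |: [set x; s x]).
    by apply/setP=> w; rewrite !inE; do !case: (_ == _).
  have szx : s z != x by rewrite -[X in _ != X]e (inj_eq perm_inj).
  have szsx : s z != s x by rewrite (inj_eq perm_inj).
  by rewrite !cardsU1 cards1 !inE (negPf zx) (negPf zsx) (negPf zs)
    (negPf szx) (negPf szsx) (eq_sym x) (negPf nsx) cs.
have u : uniq [:: x; s x; s (s x)].
  by rewrite /= !inE negb_or !(eq_sym x) nsx n3 eq_sym nssx.
have m3 : moved s = [set x; s x; s (s x)].
  apply/eqP; rewrite eq_sym eqEcard !subUset !sub1set xs sxs ssxs cs /=.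
  by rewrite setUC !cardsU1 cards1 !inE (negPf n3) (negPf nssx)
    (eq_sym x) (negPf nsx).
split=> //.
have : s (s (s x)) \in moved s by rewrite moved_perm.
rewrite m3 !inE !(inj_eq perm_inj) (negPf nsx) (negPf n3) !orbF.
by move/eqP.
Qed.

Lemma moved3_eq s t x : #|moved s| = 3 -> #|moved t| = 3 -> x \in moved s ->
  s x = t x -> s (s x) = t (t x) -> s = t.
Proof.
move=> cs ct xs e1 e2.
have xt : x \in moved t by move: xs; rewrite !movedE e1.
have [_ s3 ms] := moved3_orbit cs xs; have [_ t3 mt] := moved3_orbit ct xt.
have mst : moved s = moved t by rewrite ms mt -e2 -e1.
apply/permP=> y; have [ys|yns] := boolP (y \in moved s); last first.
  by rewrite fixedE // fixedE // -mst.
move: ys; rewrite ms !inE => /orP[/orP[]|] /eqP-> //.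
  by rewrite e2 e1.
by rewrite s3 e2 t3.
Qed.

Lemma moved3_pair s x y : #|moved s| = 3 -> x \in moved s -> y \in moved s ->
  x != y -> s x = y \/ s y = x.
Proof.
move=> cs xs; have [_ s3 ->] := moved3_orbit cs xs.
rewrite !inE => /orP[/orP[]|] /eqP-> //; first by rewrite eqxx.
  by left.
by right.
Qed.

Lemma moved3_third s x y z : #|moved s| = 3 -> s x = y -> x != y ->
  z \in moved s -> z != x -> z != y -> s y = z /\ s z = x.
Proof.
move=> cs e nxy zs zx zy; have xs : x \in moved s by rewrite movedE e eq_sym.
have [_ s3 ms] := moved3_orbit cs xs; move: zs;
  rewrite ms !inE e (negPf zx) (negPf zy) /=.
by move/eqP=> ->; split=> //; rewrite -[RHS]s3 e.
Qed.

Lemma movedV s : moved (s^-1)%g = moved s.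
Proof.
by apply/setP=> x; rewrite !movedE -(inj_eq (@perm_inj _ s)) permKV eq_sym.
Qed.

Lemma moved3V s t x : #|moved s| = 3 -> #|moved t| = 3 -> 
  x \in moved s -> t (s x) = x -> moved t = moved s -> t = (s^-1)%g.
Proof.
move=> cs ct xs e mst; have [u s3 ms] := moved3_orbit cs xs.
move: u; rewrite /= !inE negb_or andbT => /andP[/andP[n1 n2] n3].
have zt : s (s x) \in moved t by rewrite mst !moved_perm.
have := moved3_third ct e _ zt;
  rewrite !(eq_sym (s (s x))) (eq_sym (s x)) n1 n2 n3 => -[] // e1 e2.
apply: (@moved3_eq _ _ x) => //; rewrite ?movedV ?mst //.
  by rewrite e1 -[X in _ = (s^-1)%g X]s3 permK.
by rewrite e1 e2 -[X in _ = (s^-1)%g ((s^-1)%g X)]s3 !permK. 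
Qed.

(** * Coherent families of oriented triples *)

Definition clique3 (F : {set {perm T}}) : Prop :=
  [/\ {in F, forall s, #|moved s| = 3},
      {in F &, forall s t, exists2 x, x \in moved s & x \in moved t}
    & {in F &, forall s t x, x \in moved s -> t (s x) = x -> t = (s^-1)%g}].

Implicit Types (F G : {set {perm T}}).

Lemma clique3S F G : G \subset F -> clique3 F -> clique3 G.
Proof.
move=> /subsetP GF [F3 FI FC]; split=> [s /GF|s t /GF ? /GF ?|s t /GF ? /GF ?].
- exact: F3.
- exact: FI.
- exact: FC.
Qed.

Definition moving F v := [set s in F | v \in moved s].
Definition fixing F v := [set s in F | v \notin moved s].

Lemma card_moving_fixing F v : #|F| = #|moving F v| + #|fixing F v|.
Proof.
rewrite -(cardsID [set s | v \in moved s] F); congr (_ + _).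
  by apply: eq_card=> s; rewrite !inE.
by apply: eq_card=> s; rewrite !inE andbC.
Qed.

Lemma moving_sub F v : moving F v \subset F.
Proof. by apply/subsetP=> s; rewrite !inE => /andP[]. Qed.
Lemma fixing_sub F v : fixing F v \subset F.
Proof. by apply/subsetP=> s; rewrite !inE => /andP[]. Qed.

Lemma codegree_dir F v w (N : {set T}) : clique3 F -> v != w ->
    {in F, forall s, s v = w} ->
    {in F, forall s, moved s \subset v |: (w |: N)} ->
  #|F| <= #|N|.
Proof.
move=> [F3 FI FC] nvw Fvw FN.
have vs s : s \in F -> v \in moved s by move=> sF; rewrite movedE Fvw // eq_sym.
have inj : {in F &, injective (fun s : {perm T} => s w)}.
  by move=> s t sF tF /= e; apply: (@moved3_eq _ _ v); rewrite ?F3 ?vs // ?Fvw.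
rewrite -(card_in_imset inj);
  apply/subset_leq_card/subsetP=> _ /imsetP[s sF ->].
have [] := moved3_orbit (F3 _ sF) (vs _ sF); rewrite Fvw //= !inE negb_or.
case/and3P=> /andP[_ n1] n2 _ _ _.
have: s w \in moved s by rewrite moved_perm -[X in X \in _](Fvw _ sF)
  moved_perm vs.
by move/(subsetP (FN _ sF)); rewrite !inE !(eq_sym (s w)) (negPf n1) (negPf n2).
Qed.

(** If some s goes from v to w and some t from w to v, coherence with s and t turns
    every member into s^-1 or t^-1. *)
Lemma codegree F v w (N : {set T}) : clique3 F -> v != w ->
    {in F, forall s, (v \in moved s) && (w \in moved s)} ->
    {in F, forall s, moved s \subset v |: (w |: N)} ->
  #|F| <= maxn 2 #|N|.
Proof.
move=> Fc nvw Fvw FN; have [F3 FI FC] := Fc.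
have dir s : s \in F -> s v = w \/ s w = v.
  by move=> sF; case/andP: (Fvw _ sF) => *; apply: moved3_pair; rewrite ?F3.
have [/exists_inP[s sF /eqP sv]|/exists_inPn no1] :=
  boolP [exists s in F, s v == w]; last first.
  apply: leq_trans (leq_maxr _ _); apply: (@codegree_dir F w v) => //.
  - by rewrite eq_sym.
  - by move=> s sF; case: (dir s sF) => // e; have := no1 s sF; rewrite e eqxx.
  - by move=> s /FN; rewrite setUCA.
have [/exists_inP[t tF /eqP tw]|/exists_inPn no2] :=
  boolP [exists s in F, s w == v]; last first.
  apply: leq_trans (leq_maxr _ _); apply: (@codegree_dir F v w) => //.
  by move=> t tF; case: (dir t tF) => // e; have := no2 t tF; rewrite e eqxx.
apply: leq_trans (leq_maxl _ _).
apply: (@leq_trans #|[set (s^-1)%g; (t^-1)%g]|); last by rewrite cards2;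
  case: (_ != _).
apply/subset_leq_card/subsetP=> r rF; rewrite !inE.
case: (dir r rF) => e.
  rewrite (FC t r tF rF w) ?eqxx ?orbT //; last by rewrite tw.
  by rewrite movedE tw.
rewrite (FC s r sF rF v) ?eqxx //; last by rewrite sv.
by rewrite movedE sv eq_sym.
Qed.

Lemma moved3_set s v w u : #|moved s| = 3 -> uniq [:: v; w; u] ->
  v \in moved s -> w \in moved s -> u \in moved s -> moved s = [set v; w; u].
Proof.
move=> cs; rewrite /= !inE negb_or andbT => /andP[/andP[n1 n2] n3] vs ws us.
apply/eqP; rewrite eq_sym eqEcard !subUset !sub1set vs ws us cs /= setUC.
by rewrite !cardsU1 cards1 !inE !(eq_sym u) (negPf n1) (negPf n2) (negPf n3).
Qed.

Lemma moved3_sub s v w u (N : {set T}) : #|moved s| = 3 -> v != w ->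
  v \in moved s -> w \in moved s -> u \in moved s -> u != v -> u != w ->
  u \in N -> moved s \subset v |: (w |: N).
Proof.
move=> cs nvw vs ws us uv uw uN; rewrite (@moved3_set s v w u) //.
  by rewrite !subUset !sub1set !inE !eqxx uN !orbT.
by rewrite /= !inE negb_or !(eq_sym _ u) nvw uv uw.
Qed.

Lemma double_count F (W : {set T}) (g : {perm T} -> nat) :
  \sum_(w in W) \sum_(s in moving F w) g s
  = \sum_(s in F) #|W :&: moved s| * g s.
Proof.
rewrite (exchange_big_dep (fun s => s \in F)) /=; last first.
  by move=> w s _; rewrite inE => /andP[].
apply: eq_bigr => s sF; rewrite sum_nat_const; congr (_ * _).
by apply: eq_card => w; rewrite unfold_in /= !inE sF.
Qed.

Lemma card_cover_moved F (W : {set T}) k :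
    {in F, forall s, exists2 w, w \in W & w \in moved s} ->
    {in W, forall w, #|moving F w| <= k} ->
  #|F| <= #|W| * k.
Proof.
move=> FW Wk; apply: (@leq_trans (\sum_(w in W) \sum_(s in moving F w) 1)).
  rewrite double_count -sum1_card; apply: leq_sum => s sF;
    rewrite muln1 card_gt0.
  by case: (FW s sF) => w wW ws; apply/set0Pn; exists w; rewrite inE wW.
by rewrite -sum_nat_const; apply: leq_sum => w wW; rewrite sum1_card Wk.
Qed.

Lemma clique3_opp F s t x y : clique3 F -> s \in F -> t \in F ->
  s x = y -> t y = x -> x != y -> moved t = moved s.
Proof.
move=> [F3 FI FC] sF tF e1 e2 nxy; rewrite (FC s t sF tF x) ?movedV //.
  by rewrite movedE e1 eq_sym.
by rewrite e1.
Qed.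

(** The members that move v and at most one point of t are counted by the point
    w outside t that they move besides v: [codegree] allows at most three of them
    for each w.  If some member s0 moves v and two points of t, it goes
    v -> x -> y -> v, say; triples on {v, w, x} and {v, w, y} would have to follow
    v -> x and y -> v, hence would run through the pair {v, w} in opposite
    directions, so only two are left for each w.  This compensates for the at
    most six members that move two points of t, since 6 <= n - 4. *)
Lemma degree_le F v t : clique3 F -> t \in F -> v \notin moved t ->
  10 <= #|T| -> #|moving F v| <= 3 * (#|T| - 4).
Proof.
move=> Fc tF vt n10; have [F3 FI FC] := Fc.
pose X := moved t; pose G := moving F v.
have GF : G \subset F := moving_sub F v.
pose I := [set s in G | 1 < #|moved s :&: X|].
have IG : I \subset G by apply/subsetP=> s; rewrite inE => /andP[].
have cX : #|X| = 3 by apply: F3.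
have cXu u : u \in X -> #|X :\ u| = 2.
  by move=> uX; have := cardsD1 u X; rewrite cX uX => -[].
pose W := ~: (v |: X).
have cW : #|W| = #|T| - 4.
  by rewrite /W cardsCs setCK cardsU1 vt cX.
have GP s : s \in G -> [/\ s \in F, v \in moved s & #|moved s| = 3].
  by rewrite inE => /andP[sF vs]; split=> //; apply: F3.
have IX s : s \in I -> moved s \subset v |: X.
  rewrite inE => /andP[/GP[sF vs cs] c2]; apply/subsetP=> z zs.
  rewrite !inE -implyNb; apply/implyP=> nzv; apply: contraLR c2 => zX.
  have := cardsID X (moved s); rewrite cs -leqNgt.
  suff : 1 < #|moved s :\: X| by lia.
  rewrite -(_ : #|[set z; v]| = 2); last by rewrite cards2 nzv.
  by apply/subset_leq_card; rewrite subUset !sub1set !inE zs vs zX vt.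
have IS : #|I| <= 6.
  rewrite -[6]/(3 * 2) -cX; apply: card_cover_moved.
    move=> s sI; case: (FI s t) => [|//|x xs xt]; last by exists x.
    by case/(subsetP IG)/GP: sI.
  move=> u uX; have nvu : v != u by apply: contraNneq vt => ->.
  apply: leq_trans (@codegree _ v u (X :\ u) _ nvu _ _) _.
  - by apply: clique3S Fc;
      rewrite (subset_trans (moving_sub _ _)) ?(subset_trans IG).
  - by move=> s; rewrite inE => /andP[/(subsetP IG)/GP[_ -> _]].
  - move=> s; rewrite inE => /andP[sI us]; apply: subset_trans (IX _ sI) _.
    by rewrite setUS // setD1K.
  - by rewrite cXu.
have meet w s : w \in W -> s \in moving G w ->
    [/\ s \in F, v \in moved s, w \in moved s, #|moved s| = 3 & exists u,
      [/\ u \in X, u \in moved s & moved s = [set v; w; u]]].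
  move=> wW; rewrite inE => /andP[/GP[sF vs cs] ws]; move: wW;
    rewrite !inE negb_or => /andP[wv wX].
  split=> //; case: (FI s t sF tF) => u us ut; exists u; split=> //.
  apply: moved3_set => //; rewrite /= !inE negb_or eq_sym wv /= andbT.
  apply/andP; split; first by apply: contraNneq vt => ->.
  by apply: contraNneq wX => ->.
have EW k : {in W, forall w, #|moving G w| <= k} ->
    #|G :\: I| <= (#|T| - 4) * k.
  move=> Wk; rewrite -cW; apply: card_cover_moved => [s|w wW].
    rewrite inE => /andP[sI sG]; have [sF vs cs] := GP _ sG.
    move: sI; rewrite inE sG /= -leqNgt => le1.
    have /set0Pn[w] : (moved s :\: X) :\ v != set0.
      rewrite -card_gt0; have := cardsID X (moved s); rewrite cs.
      have := cardsD1 v (moved s :\: X); rewrite in_setD vt vs /=; lia.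
    rewrite !inE => /and3P[wv wX ws]; exists w => //.
    by rewrite !inE negb_or wv.
  apply: leq_trans (Wk w wW); apply: subset_leq_card.
  by apply/subsetP=> s; rewrite !inE => /andP[/andP[_ ->]].
have cG : #|G| = #|I| + #|G :\: I| by rewrite -(cardsID I G) (setIidPr IG).
have Gc w : clique3 (moving G w).
  by apply: clique3S Fc; rewrite (subset_trans (moving_sub _ _)).
have nvw w : w \in W -> v != w by rewrite !inE negb_or eq_sym => /andP[].
rewrite -/G cG; have [I0|/set0Pn[s0 s0I]] := eqVneq I set0.
  rewrite [in #|I|]I0 cards0 add0n mulnC; apply: EW => w wW.
  apply: leq_trans (@codegree _ v w X _ (nvw w wW) _ _) _ => //.
  - by move=> s /(meet _ _ wW)[_ -> ->].
  - move=> s /(meet _ _ wW)[_ _ _ _ [u [uX _ ->]]].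
    by rewrite !subUset !sub1set !inE !eqxx (_ : u \in X) ?orbT.
  - by rewrite cX.
suff /EW : {in W, forall w, #|moving G w| <= 2} by lia.
move=> w wW.
have [s0F vs0 cs0] := GP _ (subsetP IG _ s0I).
set x := s0 v; set y := s0 x.
have [u0 s03 ms0] := moved3_orbit cs0 vs0; rewrite -/x -/y in u0 s03 ms0.
move: u0; rewrite /= !inE negb_or andbT => /andP[/andP[nvx nvy] nxy].
have xX : x \in X.
  by have := subsetP (IX _ s0I) x;
    rewrite !moved_perm in_setU1 eq_sym (negPf nvx); apply.
have yX : y \in X.
  by have := subsetP (IX _ s0I) y;
    rewrite !moved_perm in_setU1 eq_sym (negPf nvy); apply.
have nwX u : u \in X -> u != w.
  by move=> uX; apply: contraTneq wW => <-;
    rewrite !inE negb_or negb_and !negbK uX orbT.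
have ws0 : w \notin moved s0.
  by apply: contraTN wW => /(subsetP (IX _ s0I)); rewrite in_setC => ->.
have main u : u \in X -> {in moving G w, forall s, u \notin moved s} ->
  #|moving G w| <= 2.
  move=> uX un.
  apply: leq_trans (@codegree _ v w (X :\ u) _ (nvw w wW) _ _) _ => //.
  - by move=> s /(meet _ _ wW)[_ -> ->].
  - move=> s sE; have [_ _ _ _ [u' [u'X u's ->]]] := meet _ _ wW sE.
    rewrite !subUset !sub1set !inE !eqxx u'X /= andbT.
    by rewrite (_ : u' != u) ?orbT //; apply: contraTneq u's => ->; apply: un.
  - by rewrite cXu.
have [/exists_inP[s1 s1E xs1]|/exists_inPn nox] :=
  boolP [exists s in moving G w, x \in moved s]; last first.
  exact: (main x).
apply: (main y) => // s2 s2E; apply/negP => ys2.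
have [s1F vs1 ws1 cs1 _] := meet _ _ wW s1E.
have [s2F vs2 ws2 cs2 _] := meet _ _ wW s2E.
have s1v : s1 v = x.
  case: (moved3_pair cs1 vs1 xs1 nvx) => // e; case/negP: ws0.
  by rewrite -(clique3_opp Fc s0F s1F (erefl x) e nvx).
have s2y : s2 y = v.
  case: (moved3_pair cs2 vs2 ys2 nvy) => // e; case/negP: ws0.
  by rewrite -(clique3_opp Fc s0F s2F s03 e) // eq_sym.
have nwv : w != v by rewrite eq_sym nvw.
have nwx : w != x by rewrite eq_sym nwX.
have nwy : w != y by rewrite eq_sym nwX.
have nyv : y != v by rewrite eq_sym.
have [_ s1w] := moved3_third cs1 s1v nvx ws1 nwv nwx.
have [s2v _] := moved3_third cs2 s2y nyv ws2 nwy nwv.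
have ms21 := clique3_opp Fc s1F s2F s1w s2v nwv.
have: x \in moved s2 by rewrite ms21.
rewrite (@moved3_set s2 v w y) //; last first.
  by rewrite /= !inE negb_or nvw // nvy eq_sym nwX.
by rewrite !inE (eq_sym x v) (negPf nvx) (negPf (nwX _ xX)) (negPf nxy).
Qed.

(** * Cliques without a common point *)

(** Count the members through a by the points of t, where a member gets weight 2
    at the only point of t it moves, or weight 1 at each of two such points: its
    total weight is at least 2.  At a point u the members through a and u meet a
    triple r avoiding both, so there are at most three; if there are exactly
    three, their third points fill r, which meets t, and hence one of them has
    weight 1.  The total weight at u is thus at most 2 + 2 + 1, and twice the
    degree of a is at most 15. *)
Lemma degree_uncovered F a t : clique3 F -> t \in F -> a \notin moved t ->
    (forall u, u != a ->
       exists2 r, r \in F & (a \notin moved r) && (u \notin moved r)) ->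
  #|moving F a| <= 7.
Proof.
move=> Fc tF at' Fun; have [F3 FI FC] := Fc.
pose X := moved t; pose G := moving F a.
pose g s := if 1 < #|X :&: moved s| then 1 else 2.
have GP s : s \in G -> s \in F /\ a \in moved s by rewrite inE => /andP[].
have g2 s : g s <= 2 by rewrite /g; case: ifP.
suff : #|G| * 2 <= #|X| * 5 by rewrite -/G F3 //; lia.
apply: (@leq_trans (\sum_(u in X) \sum_(s in moving G u) g s)).
  rewrite double_count -sum_nat_const; apply: leq_sum => s /GP[sF _].
  have : 0 < #|X :&: moved s|.
    by rewrite card_gt0; apply/set0Pn; case: (FI t s) => // x xt xs; exists x;
      rewrite inE xt.
  by rewrite /g; case: ifP => *; lia.
rewrite -sum_nat_const; apply: leq_sum => u uX.
have nua : u != a by apply: contraNneq at' => <-.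
have [r rF /andP[ar ur]] := Fun u nua.
pose E := moving G u.
have EP s : s \in E -> [/\ s \in F, a \in moved s & u \in moved s].
  by rewrite inE => /andP[/GP[]].
pose N := [set y in moved r | [exists s in E, y \in moved s]].
have Nr : N \subset moved r by apply/subsetP=> y; rewrite inE => /andP[].
have EN : #|E| <= maxn 2 #|N|.
  apply: (@codegree _ a u).
  - apply: clique3S Fc.
    by rewrite (subset_trans (moving_sub _ _)) ?(subset_trans (moving_sub _ _)).
  - by rewrite eq_sym.
  - by move=> s /EP[_ -> ->].
  - move=> s sE; have [sF as' us] := EP s sE.
    have [y ys yr] := FI s r sF rF; apply: (@moved3_sub s a u y) => //.
    + exact: F3.
    + by rewrite eq_sym.
    + by apply: contraNneq ar => <-.
    + by apply: contraNneq ur => <-.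
    + by rewrite inE yr; apply/exists_inP; exists s.
have [N2|N3] := leqP #|N| 2.
  apply: (@leq_trans (\sum_(s in E) 2)); first exact: leq_sum.
  by rewrite sum_nat_const; move: EN; rewrite (maxn_idPl N2); lia.
have cr : #|moved r| = 3 by apply: F3.
have eN : N = moved r by apply/eqP; rewrite eqEcard Nr cr.
have [y yr yt] := FI r t rF tF.
have : y \in N by rewrite eN.
rewrite inE => /andP[_ /exists_inP[s sE ys]].
have [sF _ us] := EP s sE.
rewrite (bigD1 s) //=; have -> : g s = 1.
  rewrite /g -(_ : #|[set u; y]| = 2).
    by rewrite subset_leq_card // subUset !sub1set !inE uX us ys yt.
  by rewrite cards2; case: eqP => // e; rewrite e yr in ur.
apply: (@leq_trans (1 + \sum_(i in E | i != s) 2)).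
  by rewrite leq_add2l; apply: leq_sum.
have : #|E| <= 3 by move: EN; rewrite eN cr.
rewrite (cardD1 s) sE sum_nat_const.
have -> : #|[predD1 E & s]| = #|(fun i => (i \in E) && (i != s))|.
  by apply: eq_card => i; rewrite [RHS]unfold_in !inE andbC.
by rewrite /= !add1n !ltnS => k2; apply: (leq_mul k2 (leqnn 2)).
Qed.

Lemma card_uncovered F : clique3 F ->
    (forall a u, u != a ->
       exists2 r, r \in F & (a \notin moved r) && (u \notin moved r)) ->
  #|F| <= 19.
Proof.
move=> Fc Fun; have [F3 FI FC] := Fc.
have [->|/set0Pn[t tF]] := eqVneq F set0; first by rewrite cards0.
have ct : #|moved t| = 3 by apply: F3.
have DF : F :\ t \subset F by apply: subD1set.
rewrite (cardsD1 t) tF; suff : #|F :\ t| <= #|moved t| * 6 by rewrite ct.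
apply: card_cover_moved => [s /(subsetP DF) sF|u ut].
  by case: (FI t s) => // x xt xs; exists x.
have [y nyu] : exists y, y != u.
  by exists (t u); rewrite -movedE.
have [r rF /andP[ur _]] := Fun u y nyu.
have := degree_uncovered Fc rF ur (Fun u).
rewrite (cardsD1 t) inE tF ut /= add1n ltnS; apply: leq_trans.
by apply: subset_leq_card; apply/subsetP=> s;
  rewrite !inE => /andP[/andP[-> ->]].
Qed.

(** A point z cannot complete both a -> b and b -> c to triples: the first would
    go b -> z and the second z -> b.  So the sets of third points of the members
    along a -> b, b -> c and c -> a are disjoint. *)
Lemma card_dir_triangle F a b c : clique3 F -> uniq [:: a; b; c] ->
  #|[set s in F | s a == b]| + #|[set s in F | s b == c]|
  + #|[set s in F | s c == a]| <= #|T|.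
Proof.
move=> Fc; have [F3 FI FC] := Fc.
pose A (x y : T) := [set s in F | s x == y].
pose O (x y : T) := [set (s : {perm T}) y | s in A x y].
have cO x y : x != y -> #|A x y| = #|O x y|.
  move=> nxy; rewrite card_in_imset // => s t;
    rewrite !inE => /andP[sF /eqP es] /andP[tF /eqP et] e.
  by apply: (@moved3_eq _ _ x); rewrite ?F3 ?movedE ?es ?et // eq_sym.
have dis x y z : x != y -> y != z -> x != z -> O x y :&: O y z = set0.
  move=> nxy nyz nxz; apply/eqP; rewrite -subset0; apply/subsetP=> w;
    rewrite !inE.
  case/andP=> /imsetP[s + sy] /imsetP[t];
    rewrite !inE => /andP[sF /eqP sx] /andP[tF /eqP ty] tz.
  have ys : y \in moved s by rewrite -sx moved_perm movedE sx eq_sym.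
  have yt : y \in moved t by rewrite movedE ty eq_sym.
  have [_ s3 _] := moved3_orbit (F3 _ sF) ys;
    have [_ t3 _] := moved3_orbit (F3 _ tF) yt.
  rewrite ty -tz in t3; rewrite -sy in s3.
  have e := FC s t sF tF y ys; rewrite -sy t3 in e.
  by move: ty; rewrite e // -sx permK => /eqP; rewrite (negPf nxz).
rewrite /= !inE negb_or andbT -/(A a b) -/(A b c) -/(A c a) 
  => /andP[/andP[nab nac] nbc].
have [nba nca ncb] : [/\ b != a, c != a & c != b] by rewrite (eq_sym b)
  !(eq_sym c).
rewrite !cO //.
have e1 := cardsUI (O a b) (O b c); rewrite dis // cards0 addn0 in e1.
have e2 := cardsUI (O a b :|: O b c) (O c a).
rewrite setIUl (setIC (O a b)) !dis // setU0 cards0 addn0 e1 in e2.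
by rewrite -e2; apply: max_card.
Qed.

(** Each member follows a side of one of the two orientations of the triangle
    a, b, c. *)
Lemma card_two_of_three F a b c : clique3 F -> uniq [:: a; b; c] ->
    {in F, forall s, [|| (a \in moved s) && (b \in moved s),
       (b \in moved s) && (c \in moved s) |
       (a \in moved s) && (c \in moved s)]} ->
  #|F| <= 2 * #|T|.
Proof.
move=> Fc u Fabc; have [F3 FI FC] := Fc.
pose A (x y : T) := [set s in F | s x == y].
have h1 : #|A a b| + #|A b c| + #|A c a| <= #|T| by apply: card_dir_triangle.
have h2 : #|A c b| + #|A b a| + #|A a c| <= #|T|.
  by apply: card_dir_triangle => //; rewrite -rev_uniq.
have sub : F \subset
    (A a b :|: A b c :|: A c a) :|: (A c b :|: A b a :|: A a c).
  apply/subsetP=> s sF; rewrite !inE sF /=.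
  move: u; rewrite /= !inE negb_or andbT => /andP[/andP[nab nac] nbc].
  have P x y : x != y -> x \in moved s -> y \in moved s ->
      (s x == y) || (s y == x).
    by move=> n xs ys; case: (moved3_pair (F3 _ sF) xs ys n) => ->;
      rewrite eqxx ?orbT.
  by case/or3P: (Fabc s sF) => /andP[xs ys];
    [have := P _ _ nab xs ys|have := P _ _ nbc xs ys|have := P _ _ nac xs ys];
    case/orP=> ->; rewrite ?orbT.
have U (B C D : {set {perm T}}) : #|B :|: C :|: D| <= #|B| + #|C| + #|D|.
  by rewrite (leq_trans (leq_card_setU _ _)) ?leq_add2r ?leq_card_setU.
rewrite mul2n -addnn; apply: leq_trans (subset_leq_card sub) _.
apply: leq_trans (leq_card_setU _ _) _.
by apply: leq_add; apply: leq_trans (U _ _ _) _.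
Qed.

(** Let t be a member that fixes b; it moves a.  A member that fixes a moves b and
    one of the two other points u of t, and it must also meet a member that fixes
    b and u, in one of two points: at most two choices for each u. *)
Lemma card_fixing_le4 F a b : clique3 F -> a != b ->
    {in F, forall s, (a \in moved s) || (b \in moved s)} ->
    (forall c, c != a -> exists2 s, s \in fixing F b & c \notin moved s) ->
  #|fixing F a| <= 4.
Proof.
move=> Fc nab Fab Fb; have [F3 FI FC] := Fc.
have FbP t : t \in fixing F b ->
    [/\ t \in F, b \notin moved t, a \in moved t & #|moved t :\ a| = 2].
  rewrite inE => /andP[tF bt]; have at' : a \in moved t by have := Fab t tF;
    rewrite (negPf bt) orbF.
  by split=> //; have := cardsD1 a (moved t); rewrite at' F3 // => -[].
have nba : b != a by rewrite eq_sym.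
have [t /FbP[tF bt at' ct] _] := Fb b nba.
rewrite -[4]/(2 * 2) -{1}ct; apply: card_cover_moved => [s|u].
  rewrite inE => /andP[sF as']; have [x xt xs] := FI t s tF sF.
  by exists x => //; rewrite !inE xt andbT; apply: contraNneq as' => <-.
rewrite !inE => /andP[nua ut]; have nub : u != b by apply: contraNneq bt => <-.
have [r /FbP[rF br ar cr] ur] := Fb u nua.
rewrite -[2]/(maxn 2 2) -[X in maxn _ X]cr; apply: (@codegree _ b u).
- apply: clique3S Fc.
  by rewrite (subset_trans (moving_sub _ _)) ?(subset_trans (fixing_sub _ _)).
- by rewrite eq_sym.
- move=> s; rewrite !inE => /andP[/andP[sF as'] ->].
  by have := Fab s sF; rewrite (negPf as') /= => ->.
- move=> s; rewrite !inE => /andP[/andP[sF as'] us].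
  have [z zs zr] := FI s r sF rF; apply: (@moved3_sub s b u z) => //.
  + exact: F3.
  + by rewrite eq_sym.
  + by have := Fab s sF; rewrite (negPf as').
  + by apply: contraNneq br => <-.
  + by apply: contraNneq ur => <-.
  + by rewrite !inE zr andbT; apply: contraNneq as' => <-.
Qed.

(** Every member moves two of a, b, c: the point to check is that members that fix
    a move c.  At least three members move a and c and fix b, and by [codegree]
    they have at least three third points.  A member that fixes a and c would have
    to move all of these, and b as well. *)
Lemma card_fixing_star F a b c : clique3 F -> a != b -> c != a ->
    {in F, forall s, (a \in moved s) || (b \in moved s)} ->
    {in fixing F b, forall s, c \in moved s} -> 2 < #|fixing F b| ->
  #|F| <= 2 * #|T|.
Proof.
move=> Fc nab nca Fab Fbc c3; have [F3 FI FC] := Fc.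
have /card_gt0P[t0 t0Fb] : 0 < #|fixing F b| by apply: leq_trans c3.
have FbP t : t \in fixing F b -> [/\ t \in F, b \notin moved t & a \in moved t].
  rewrite inE => /andP[tF bt]; split=> //.
  by have := Fab t tF; rewrite (negPf bt) orbF.
have ncb : c != b.
  by have [_ bt _] := FbP _ t0Fb; apply: contraNneq bt => <-; apply: Fbc.
apply: (@card_two_of_three _ a b c) => //.
  by rewrite /= !inE negb_or nab eq_sym nca eq_sym ncb.
move=> s sF; have := Fab s sF.
have [bs _|bs] := boolP (b \in moved s); last first.
  by rewrite orbF => ->; rewrite Fbc ?orbT // inE sF.
have [//|as'] := boolP (a \in moved s); rewrite /= orbF.
apply: contraLR c3 => cs; rewrite -leqNgt.
have c2 : #|moved s :\ b| = 2.
  by have := cardsD1 b (moved s); rewrite bs F3 // => -[].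
rewrite -[2]/(maxn 2 2) -[X in maxn _ X]c2; apply: (@codegree _ a c).
- by apply: clique3S Fc; apply: fixing_sub.
- by rewrite eq_sym.
- by move=> t tFb; have [_ _ ->] := FbP t tFb; rewrite Fbc.
- move=> t tFb; have [tF bt at'] := FbP t tFb; have [z zs zt] := FI s t sF tF.
  apply: (@moved3_sub t a c z) => //.
  + exact: F3.
  + by rewrite eq_sym.
  + exact: Fbc.
  + by apply: contraNneq as' => <-.
  + by apply: contraNneq cs => <-.
  + by rewrite !inE zs andbT; apply: contraNneq bt => <-.
Qed.

Lemma card_covered F a b : clique3 F -> a != b -> 10 <= #|T| ->
    {in F, forall s, (a \in moved s) || (b \in moved s)} ->
    fixing F a != set0 -> fixing F b != set0 ->
  #|F| <= 3 * #|T| - 10.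
Proof.
move=> Fc nab n10 Fab Fa0 Fb0.
have Fba : {in F, forall s, (b \in moved s) || (a \in moved s)}.
  by move=> s sF; rewrite orbC Fab.
have nba : b != a by rewrite eq_sym.
have deg v : fixing F v != set0 -> #|moving F v| <= 3 * (#|T| - 4).
  by case/set0Pn=> t; rewrite inE => /andP[tF vt]; apply: degree_le vt _.
have [la|la] := leqP #|fixing F a| 2.
  by rewrite (card_moving_fixing F a); have := deg a Fa0; lia.
have [lb|lb] := leqP #|fixing F b| 2.
  by rewrite (card_moving_fixing F b); have := deg b Fb0; lia.
have star x y : {in F, forall s, (x \in moved s) || (y \in moved s)} ->
    x != y -> 2 < #|fixing F y| ->
    #|F| <= 2 * #|T| \/ #|fixing F x| <= 4.
  move=> Fxy nxy ly.
  have [/existsP[c /andP[nca /forall_inP Fc']]|no] :=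
    boolP [exists c, (c != x) && [forall s in fixing F y, c \in moved s]].
    by left; apply: (card_fixing_star Fc nxy nca Fxy).
  right; apply: (card_fixing_le4 Fc nxy Fxy) => c nc.
  move: no; rewrite negb_exists => /forallP/(_ c);
    rewrite nc /= => /forall_inPn[s ? ?].
  by exists s.
have [|fa] := star a b Fab nab lb; first by lia.
have [|fb] := star b a Fba nba la; first by lia.
have fb' : #|fixing (moving F a) b| <= 4.
  apply: leq_trans fb; apply: subset_leq_card.
  by apply/subsetP=> s; rewrite !inE => /andP[/andP[-> _] ->].
have mab : #|moving (moving F a) b| <= #|T| - 2.
  have cN : #|~: [set a; b]| = #|T| - 2 by rewrite cardsCs setCK cards2 nab.
  have -> : #|T| - 2 = maxn 2 (#|T| - 2) by lia.
  rewrite -cN; apply: (@codegree _ a b) => //.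
  - apply: clique3S Fc.
    by rewrite (subset_trans (moving_sub _ _)) ?(subset_trans (moving_sub _ _)).
  - by move=> s; rewrite !inE => /andP[/andP[_ ->] ->].
  - by move=> s _; apply/subsetP=> z _; rewrite !inE; case: (z == a);
      case: (z == b).
rewrite (card_moving_fixing F a) (card_moving_fixing (moving F a) b); lia.
Qed.

Lemma card_nonstar F : clique3 F -> 10 <= #|T| ->
  (forall v, fixing F v != set0) -> #|F| <= 3 * #|T| - 10.
Proof.
move=> Fc n10 Fns.
have [/existsP[a /existsP[b /andP[nab /forall_inP Fab]]]|no] :=
  boolP [exists a, exists b, (a != b) &&
           [forall s in F, (a \in moved s) || (b \in moved s)]].
  by apply: (card_covered Fc nab).
apply: (@leq_trans 19); last by lia.
apply: card_uncovered => // a b nba.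
move: no; rewrite negb_exists => /forallP/(_ a); rewrite negb_exists.
move=> /forallP/(_ b); rewrite eq_sym nba /= => /forall_inPn[s sF].
by rewrite negb_or => ?; exists s.
Qed.

(** * Cliques through a common point *)

Definition sources F v := [set (s : {perm T}) v | s in F].
Definition sinks F v := [set (s : {perm T}) (s v) | s in F].

(** If s v is also the sink of some arc then the inverse of s is a member, and s
    is determined by s v, which lies in both sets.  For any other member s, neither
    s v is a sink nor s (s v) a source, and the arc (s v, s (s v)) determines s. *)
Lemma card_star_le F v : clique3 F -> {in F, forall s, v \in moved s} ->
  #|F| <= #|sources F v :&: sinks F v|
          + #|sources F v :\: sinks F v| * #|sinks F v :\: sources F v|.
Proof.
move=> Fc Fv; have [F3 FI FC] := Fc.
set S := sources F v; set R := sinks F v.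
pose D := [set s in F | (s : {perm T}) v \in R].
have DV s : s \in D -> exists2 t, t \in F & t = (s^-1)%g.
  rewrite inE => /andP[sF /imsetP[t tF e]]; exists t => //.
  apply: (FC s t sF tF v); first exact: Fv.
  by rewrite e; have [] := moved3_orbit (F3 _ tF) (Fv _ tF).
rewrite -(cardsID D F); apply: leq_add.
  have injD : {in F :&: D &, injective (fun s : {perm T} => s v)}.
    move=> s t; rewrite !inE => /andP[sF sD] /andP[tF tD] /= e.
    have [s' s'F es] : exists2 r, r \in F & r = (s^-1)%g by apply: DV;
      rewrite inE.
    have := FC s' t s'F tF (s v); rewrite movedE es.
    rewrite permK {1}e => ->; rewrite ?invgK //.
    by rewrite eq_sym -movedE Fv.
  rewrite -(card_in_imset injD); apply: subset_leq_card;
    apply/subsetP=> _ /imsetP[s sFD ->].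
  move: sFD; rewrite !inE => /andP[sF /andP[_ sR]]; rewrite sR andbT.
  exact: imset_f.
pose f (s : {perm T}) := (s v, s (s v)).
have injf : {in F :\: D &, injective f}.
  move=> s t; rewrite !inE => /andP[_ sF] /andP[_ tF] [e1 e2].
  by apply: (@moved3_eq _ _ v); rewrite ?F3 ?Fv.
rewrite -(card_in_imset injf) -cardsX; apply: subset_leq_card.
apply/subsetP=> _ /imsetP[s sFD ->]; move: sFD; rewrite !inE /= => /andP[sD sF].
have -> : s v \in S by apply: imset_f.
have -> : s (s v) \in R by apply: (imset_f (fun s : {perm T} => s (s v))).
move: sD; rewrite sF /= => sR; rewrite sR /= andbT;
  apply: contra sR => /imsetP[t tF e].
have [_ s3 _] := moved3_orbit (F3 _ sF) (Fv _ sF).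
have es : s = (t^-1)%g by apply: (FC t s tF sF v); rewrite ?Fv // -e.
apply/imsetP; exists t => //; by rewrite -e {2}es permKV.
Qed.

End ThreeCycles.

(** * The numerical estimates *)

(** The size m is the number of points other than the common one, a and b are the
    numbers of pure sources and pure sinks, and d that of the points which are
    both. *)
Lemma star_arith m a b d : 9 <= m -> a + b + d <= m ->
  d + a * b <= m ^ 2 %/ 4 /\ (m ^ 2 %/ 4 <= d + a * b -> d = 0).
Proof.
move=> m9 abd.
have agm : 4 * (a * b) <= (a + b) ^ 2 by apply: (nat_AGM2 a b).1.
have [k [ek lek]] : exists k, m = k + d /\ a + b <= k.
  by exists (m - d); split; lia.
have sq : 4 * (a * b) <= k * k.
  by apply: leq_trans agm _; rewrite mulnn leq_sqr.
have {agm} key : d = 0 \/ 4 * (d + a * b) + 4 <= m ^ 2.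
  case: d abd ek => [|d] abd ek; [by left | right].
  by rewrite ek -mulnn; move: (a * b) sq => p sq; nia.
have d0 : d = 0 -> 4 * (d + a * b) <= m ^ 2 by move=> d0; rewrite -mulnn; nia.
split; first by rewrite leq_divRL //; lia.
by move=> h; case: key => // key; move: h; rewrite leqNgt leq_divRL //; lia.
Qed.

Lemma balanced_arith n a b : 10 <= n -> a + b <= n.-1 ->
    (n - 1) ^ 2 %/ 4 <= a * b ->
  [/\ a + b = n.-1, a = n./2 \/ b = n./2 & odd n -> a = n./2].
Proof.
move=> n10 ab; rewrite -ltnS ltn_divLR // subn1 => h.
have agm : 4 * (a * b) <= (a + b) ^ 2 by apply: (nat_AGM2 a b).1.
have eab : a + b = n.-1.
  apply/eqP; rewrite eqn_leq ab leqNgt; apply/negP => lt.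
  have : (a + b).+1 ^ 2 <= n.-1 ^ 2 by rewrite leq_sqr.
  rewrite -addn1 sqrnD; have : 8 <= n.-1.-1 by lia.
  case: (leqP 2 (a + b)) => [ge2|]; first by lia.
  by rewrite -!mulnn in agm h *; nia.
(* If a and b differed by 2 or more, (a + b)^2 would be at least 4ab + 4. *)
have near : a <= b.+1 /\ b <= a.+1.
  by rewrite -eab -mulnn in h; split; rewrite leqNgt; apply/negP => lt; nia.
have := odd_double_half n; case: (odd n) => /= en; split=> //; lia.
Qed.

(** * Adjacency of 3-cycles *)

Section Adjacency.
Variable T : finType.
Implicit Types (s t u : {perm T}) (x y z : T) (c : seq T).

Lemma is_cycle_on_fcycle c s : 1 < size c -> uniq c -> fcycle s c ->
  (forall x, x \notin c -> s x = x) -> is_cycle_on c s.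
Proof.
move=> c1 uc sc sf; rewrite /is_cycle_on c1 uc; apply/forallP=> x.
have [xc|xc] := boolP (x \in c); first exact: next_cycle sc xc.
by rewrite sf // next_nth (negPf xc).
Qed.

Lemma is_cycle_on_cycle c s : is_cycle_on c s -> is_cycle s.
Proof.
move=> cs; have /and3P[_ uc _] := cs.
have ltc : size c < #|T|.+1 by rewrite ltnS -(card_uniqP uc) max_card.
by apply/existsP; exists (Ordinal ltc); apply/existsP; exists (in_tuple c).
Qed.

Lemma is_kcycle3P s : reflect (#|moved s| = 3) (is_kcycle 3 s).
Proof.
apply: (iffP existsP) => [[[c /= /eqP sc]]|cs].
  case: c sc => [|x [|y [|z []]]] //= _ /and3P[_ u /forallP sn].
  have -> : moved s = [set x; y; z].
    move: u; rewrite /= !inE negb_or andbT => /andP[/andP[nxy nxz] nyz].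
    apply/setP=> w; rewrite movedE (eqP (sn w)) /= !inE !(eq_sym _ w).
    have [->|nwx] := eqVneq w x; first by rewrite nxy.
    have [->|nwy] := eqVneq w y; first by rewrite nyz.
    by have [->|nwz] := eqVneq w z; rewrite ?eqxx // eq_sym nxz.
  by rewrite setUC cardsU1 cards2; move: u;
    rewrite /= !inE !negb_or andbT !(eq_sym z) => /andP[/andP[-> ->] ->].
have /set0Pn[x xs] : moved s != set0 by rewrite -card_gt0 cs.
have [u s3 ms] := moved3_orbit cs xs.
exists [tuple x; s x; s (s x)]; apply: is_cycle_on_fcycle => //=.
  by rewrite s3 !eqxx.
by move=> y; rewrite !inE orbA => ns; apply: fixedE; rewrite ms !inE.
Qed.

Lemma cycle_closed u (A : {set T}) x y : is_cycle u ->
    {in A, forall z, u z \in A} -> x \in A -> x \in moved u -> y \in moved u ->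
  y \in A.
Proof.
case/existsP=> k /existsP[c /and3P[_ uc /forallP uE]] Au xA.
have mc z : z \in moved u -> z \in (c : seq T).
  by rewrite movedE (eqP (uE z)); apply: contraR => zc;
    rewrite next_nth (negPf zc).
move=> /mc xc /mc; rewrite -(fconnect_cycle (cycle_next uc) xc).
move/iter_findex=> <-; elim: (findex _ _ _) => //= i IH.
by rewrite -(eqP (uE _)) Au.
Qed.

Definition compatible s t : Prop :=
  (exists2 x, x \in moved s & x \in moved t) /\
  (forall x, x \in moved s -> t (s x) = x -> t = (s^-1)%g).

(** A set that is stable under t s^-1 and contains a moved point contains all of
    them.  If s and t are disjoint, the points moved by s form such a set but those
    moved by t are moved as well.  If s = (x y z) and t = (y x w) with w <> z, the
    product exchanges x and w, and moves y. *)
Lemma cycle_compatible s t : #|moved s| = 3 -> #|moved t| = 3 ->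
  is_cycle (t * s^-1)%g -> compatible s t.
Proof.
move=> cs ct cyc.
have uE x : (t * s^-1)%g x = (s^-1)%g (t x) by rewrite permM.
split.
  have [/exists_inP//|/exists_inPn dis] :=
    boolP [exists x in moved s, x \in moved t].
  have /set0Pn[x xs] : moved s != set0 by rewrite -card_gt0 cs.
  have /set0Pn[y yt] : moved t != set0 by rewrite -card_gt0 ct.
  have fs z : z \in moved s -> t z = z by move=> /dis /fixedE.
  have ft z : z \in moved t -> (s^-1)%g z = z.
    by move=> zt; apply: fixedE; rewrite movedV; apply: contraTN zt => /dis.
  have : y \in moved s.
    apply: (cycle_closed cyc _ xs).
    - by move=> z zs; rewrite uE fs // -movedV moved_perm movedV.
    - by rewrite movedE uE fs // -movedE movedV.
    - by rewrite movedE uE ft ?moved_perm // -movedE.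
  by move/dis; rewrite yt.
move=> x xs tsx; have ys : s x \in moved s by rewrite moved_perm.
have yt : s x \in moved t by rewrite movedE tsx eq_sym -movedE.
have xt : x \in moved t by rewrite -tsx moved_perm.
set y := s x in tsx ys yt; have nyx : y != x by rewrite -movedE.
have [u s3 ms] := moved3_orbit cs xs; have [v t3 mt] := moved3_orbit ct yt.
rewrite tsx in t3 v mt; rewrite -/y in s3 ms u.
set z := s y in s3 ms u; set w := t x in t3 v mt.
have [zw|nzw] := eqVneq z w.
  by apply: (@moved3V _ s t x) => //; rewrite ms mt -zw (setUC [set x]).
have sVy : (s^-1)%g y = x by rewrite permK.
have sVx : (s^-1)%g x = z by rewrite -s3 permK.
move: u v; rewrite /= !inE !negb_or !andbT => /andP[/andP[nxy nxz] nyz]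
  /andP[/andP[_ nyw] nxw].
have ws : (s^-1)%g w = w.
  by apply: fixedE; rewrite movedV ms !inE !negb_or !(eq_sym w) nxw nyw nzw.
have : y \in [set x; w].
  apply: (@cycle_closed _ _ x y cyc).
  - by move=> r; rewrite !inE => /orP[] /eqP->;
      rewrite uE ?ws ?t3 ?sVy eqxx ?orbT.
  - by rewrite !inE eqxx.
  - by rewrite movedE uE ws eq_sym.
  - by rewrite movedE uE tsx sVx eq_sym.
by rewrite !inE (negPf nyx) (negPf nyw).
Qed.

(** With s = (a b c) and t = (a d e), the product t s^-1 is (b e c) if b = d,
    (a d b) if c = e, (a d e c b) if the five points are distinct, and s itself if
    t is the inverse of s. *)
Lemma compatible_cycle s t : #|moved s| = 3 -> #|moved t| = 3 -> s != t ->
  compatible s t -> is_cycle (t * s^-1)%g.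
Proof.
move=> cs ct nst [[a as' at'] C].
have uE x : (t * s^-1)%g x = (s^-1)%g (t x) by rewrite permM.
have [] := moved3_orbit cs as'; have [] := moved3_orbit ct at'.
set b := s a; set c := s b; set d := t a; set e := t d => v t3 mt u s3 ms.
have sb : (s^-1)%g b = a by rewrite permK.
have sc : (s^-1)%g c = b by rewrite permK.
have sa : (s^-1)%g a = c by rewrite -s3 permK.
move: u v; rewrite /= !inE !negb_or !andbT => /andP[/andP[nab nac] nbc]
  /andP[/andP[nad nae] nde].
have nba : b != a by rewrite eq_sym.
have nca : c != a by rewrite eq_sym.
have ncb : c != b by rewrite eq_sym.
have nda : d != a by rewrite eq_sym.
have nea : e != a by rewrite eq_sym.
have ned : e != d by rewrite eq_sym.
have fs x : x != a -> x != b -> x != c -> (s^-1)%g x = x.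
  by move=> *; apply: fixedE; rewrite movedV ms !inE !negb_or -andbA;
    apply/and3P.
have ft x : x != a -> x != d -> x != e -> t x = x.
  by move=> *; apply: fixedE; rewrite mt !inE !negb_or -andbA; apply/and3P.
have inv : t = (s^-1)%g -> is_cycle (t * s^-1)%g.
  move=> ->; have -> : (s^-1 * s^-1 = s)%g.
    apply/permP=> x; rewrite permM; have [xs|xs] := boolP (x \in moved s).
      have [_ x3 _] := moved3_orbit cs xs.
      by rewrite -[X in (s^-1)%g ((s^-1)%g X)]x3 !permK.
    by rewrite (fixedE xs) fixedE ?movedV // fixedE ?movedV.
  by case/existsP: (introT (is_kcycle3P s) cs) => r /is_cycle_on_cycle.
have ub x : x \notin [:: a; b; c] -> x \notin [:: d; e] -> (t * s^-1)%g x = x.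
  by rewrite !inE !negb_or uE => /and3P[? ? ?] /andP[? ?]; rewrite ft // fs.
have [ebd|nbd] := eqVneq b d.
  have [ece|nce] := eqVneq c e; first by case/eqP: nst;
    apply: (@moved3_eq _ _ _ a).
  have tb : t b = e by rewrite ebd.
  have tc : t c = c by apply: ft; rewrite // -ebd.
  have se : (s^-1)%g e = e by apply: fs; rewrite 1?eq_sym // ebd.
  apply: (@is_cycle_on_cycle [:: b; e; c]); apply: is_cycle_on_fcycle => //=.
  - by rewrite !inE !negb_or nbc ebd nde eq_sym nce.
  - by rewrite !uE tb t3 tc se sa sc !eqxx.
  - move=> x; rewrite !inE !negb_or => /and3P[nb ne nc].
    have [->|nxa] := eqVneq x a; first by rewrite uE -/d -ebd.
    by apply: ub; rewrite !inE !negb_or -?ebd ?nxa nb.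
have [ebe|nbe] := eqVneq b e.
  by apply/inv/(C a) => //; rewrite -/b ebe t3.
have [ecd|ncd] := eqVneq c d.
  by apply/inv/(C c); [rewrite !moved_perm|rewrite s3 -/d].
have tb : t b = b by apply: ft.
have sd : (s^-1)%g d = d by apply: fs; rewrite 1?eq_sym.
have [ece|nce] := eqVneq c e.
  have td : t d = c by rewrite ece.
  apply: (@is_cycle_on_cycle [:: a; d; b]); apply: is_cycle_on_fcycle => //=.
  - by rewrite !inE !negb_or nad nab eq_sym nbd.
  - by rewrite !uE -/d td tb sd sc sb !eqxx.
  - move=> x; rewrite !inE !negb_or => /and3P[na nd nb].
    have [->|nxc] := eqVneq x c; first by rewrite uE ece t3 sa.
    by apply: ub; rewrite !inE !negb_or ?na ?nb ?nd -?ece.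
have tc : t c = c by apply: ft.
have se : (s^-1)%g e = e by apply: fs; rewrite 1?eq_sym.
apply: (@is_cycle_on_cycle [:: a; d; e; c; b]);
  apply: is_cycle_on_fcycle => //=.
- rewrite !inE !negb_or nad nae nac nab nde ncb !(eq_sym d) !(eq_sym e).
  by rewrite ncd nbd nce nbe.
- by rewrite !uE -/d -/e t3 tc tb sd se sa sc sb !eqxx.
- move=> x; rewrite !inE !negb_or => /and5P[na nd ne nc nb].
  by apply: ub; rewrite !inE !negb_or ?na ?nb ?nd ?ne ?nc.
Qed.

End Adjacency.

Lemma cliqueP n (F : {set 'S_n}) :
  reflect (clique3 F) (is_clique (kcycles n 3) (@birkhoff_adj n) F).
Proof.
apply: (iffP andP) => [[/subsetP FV /forall_inP Fadj]|[F3 FI FC]].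
  have F3 : {in F, forall s, #|moved s| = 3}.
    by move=> s /FV; rewrite inE => /is_kcycle3P.
  have comp s t : s \in F -> t \in F -> compatible s t.
    move=> sF tF; have [<-|nst] := eqVneq s t; last first.
      apply: cycle_compatible; rewrite ?F3 //.
      by have /forall_inP/(_ t tF) := Fadj s sF; rewrite nst.
    split; first by have /set0Pn[x xs] : moved s != set0;
      [rewrite -card_gt0 F3 | exists x].
    move=> x xs e; have [] := moved3_orbit (F3 s sF) xs.
    by rewrite e /= !inE eqxx orbT.
  by split=> // s t sF tF; have [] := comp s t sF tF.
split; first by apply/subsetP=> s sF; rewrite inE; apply/is_kcycle3P/F3.
apply/forall_inP=> s sF; apply/forall_inP=> t tF; apply/implyP=> nst.
by apply: compatible_cycle; rewrite ?F3 //; split; [apply: FI | apply: FC].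
Qed.

(** * The clique T_2(n) and its images *)

Section Symmetries.
Variable T : finType.
Implicit Types (s p : {perm T}) (F : {set {perm T}}).

Lemma movedJ s p : moved (s ^ p)%g = p @: moved s.
Proof.
apply/setP=> x; rewrite -[x](permKV p) (mem_imset _ _ (@perm_inj _ p)).
by rewrite !movedE permJ (inj_eq perm_inj).
Qed.

Lemma clique3J F p : clique3 F -> clique3 (F :^ p)%g.
Proof.
move=> [F3 FI FC]; split.
- by move=> _ /imsetP[s sF ->]; rewrite movedJ card_imset ?F3 //;
    apply: perm_inj.
- move=> s' t' /imsetP[s sF ->] /imsetP[t tF ->];
    have [x xs xt] := FI s t sF tF.
  by exists (p x); rewrite movedJ imset_f.
- move=> s' t' /imsetP[s sF ->] /imsetP[t tF ->] y;
    rewrite movedJ => /imsetP[x xs ->].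
  by rewrite !permJ => /perm_inj /(FC s t sF tF x xs)->; rewrite conjVg.
Qed.

Lemma clique3V F : clique3 F -> clique3 (F^-1)%g.
Proof.
move=> [F3 FI FC]; split.
- by move=> s; rewrite mem_invg => sF; rewrite -movedV F3.
- by move=> s t; rewrite !mem_invg -(movedV s) -(movedV t); apply: FI.
- move=> s t; rewrite !mem_invg => sF tF x xs e; apply: invg_inj.
  apply: (FC _ _ sF tF (s x)); first by rewrite movedV moved_perm.
  by rewrite permK -[X in (t^-1)%g X]e permK.
Qed.

End Symmetries.

Section Extremal.
Variable n : nat.
Hypothesis n10 : 10 <= n.

Lemma ltn_pred_n : n.-1 < n. Proof. by lia. Qed.
Definition top : 'I_n := Ordinal ltn_pred_n.

Lemma T2P (s : 'S_n) :
  reflect [/\ #|moved s| = 3, s top < n./2 & n./2 <= s (s top) < n.-1]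
          (s \in T2 n).
Proof.
rewrite inE; apply: (iffP idP).
  case/existsP=> i /existsP[j /existsP[m /and5P[ilt jge jlt /eqP em cyc]]].
  have -> : top = m by apply: val_inj.
  have k3 : is_kcycle 3 s by apply/existsP; exists [tuple i; j; m].
  have /and3P[_ u /forallP sE] := cyc.
  move: u; rewrite /= !inE negb_or andbT => /andP[/andP[nij nim] njm].
  have sm : s m = i by rewrite (eqP (sE m)) /= !(eq_sym m) eqxx (negPf nim)
    (negPf njm).
  have si : s i = j by rewrite (eqP (sE i)) /= eqxx.
  by rewrite sm si jge jlt; split=> //; apply/is_kcycle3P.
case=> s3 ilt /andP[jge jlt].
have ts : top \in moved s.
  by rewrite movedE; apply: contraTneq ilt => ->; rewrite -leqNgt /=; lia.
have [u e3 ms] := moved3_orbit s3 ts.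
apply/existsP; exists (s top); apply/existsP; exists (s (s top)).
apply/existsP; exists top; rewrite ilt jge jlt eqxx /=.
apply: is_cycle_on_fcycle => //=.
- by move: u; rewrite -(rot_uniq 1).
- by rewrite e3 !eqxx.
- by move=> x xs; apply: fixedE; rewrite ms !inE; move: xs; rewrite !inE;
    do 3!case: eqP.
Qed.

Lemma T2_clique3 : clique3 (T2 n).
Proof.
have mem s : s \in T2 n -> top \in moved s.
  case/T2P=> _ ilt _; rewrite movedE; apply: contraTneq ilt => ->.
  by rewrite -leqNgt /=; lia.
split=> [s /T2P[] //|s t /mem ? /mem ?|s t sF tF x xs]; first by exists top.
have [s3 si /andP[sj sk]] := T2P _ sF; have [t3 ti /andP[tj _]] := T2P _ tF.
have [_ s4 ms] := moved3_orbit s3 (mem s sF).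
have [_ t4 mt] := moved3_orbit t3 (mem t tF).
move: xs; rewrite ms !inE => /orP[/orP[]|] /eqP-> e.
- have /perm_inj st : t (s top) = t (t (t top)) by rewrite t4.
  by move: si; rewrite st ltnNge tj.
- have jt : s (s top) \in moved t.
    by rewrite movedE e; apply: contraTneq si => ->; rewrite -leqNgt.
  move: jt; rewrite mt !inE => /orP[/orP[]|] /eqP jE.
  + by move: sk; rewrite jE ltnn.
  + by move: ti; rewrite -jE ltnNge sj.
  + by move: si; rewrite -e jE t4 /=; lia.
- by move: ti; rewrite -{1}s4 e ltnNge sj.
Qed.

Lemma card_T2_ge : n./2 * (n.-1 - n./2) <= #|T2 n|.
Proof.
have lti (i : 'I_(n./2)) : i < n by have := ltn_ord i; lia.
have ltj (j : 'I_(n.-1 - n./2)) : n./2 + j < n by have := ltn_ord j; lia.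
pose x (i : 'I_(n./2)) := Ordinal (lti i).
pose y (j : 'I_(n.-1 - n./2)) := Ordinal (ltj j).
have nxy i j : x i != y j by apply/eqP => /(congr1 val) /=; have := ltn_ord i;
  lia.
have nxt i : x i != top by apply/eqP => /(congr1 val) /=; have := ltn_ord i;
  lia.
have nyt j : y j != top by apply/eqP => /(congr1 val) /=; have := ltn_ord j;
  lia.
have nyx i j : y j != x i by rewrite eq_sym.
have ntx i : top != x i by rewrite eq_sym.
have nty j : top != y j by rewrite eq_sym.
(* The 3-cycle top -> x i -> y j -> top. *)
pose f (q : 'I_(n./2) * 'I_(n.-1 - n./2)) : 'S_n :=
  (tperm top (x q.1) * tperm top (y q.2))%g.
have ft q : f q top = x q.1 by rewrite permM tpermL tpermD.
have fx q : f q (x q.1) = y q.2 by rewrite permM tpermR tpermL.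
have fy q : f q (y q.2) = top by rewrite permM (tpermD (nty _) (nxy _ _))
  tpermR.
have f_inj : injective f.
  move=> [i j] [i' j'] e; have := ft (i, j); rewrite e ft /= => -[] /val_inj ei.
  by have := fx (i, j); rewrite e -ei fx => -[] /addnI /val_inj ->.
have := card_imset [set: 'I_(n./2) * 'I_(n.-1 - n./2)] f_inj.
rewrite cardsT card_prod !card_ord => <-; apply: subset_leq_card.
apply/subsetP=> _ /imsetP[q _ ->]; rewrite inE; apply/existsP; exists (x q.1).
apply/existsP; exists (y q.2); apply/existsP; exists top.
have hx : x q.1 < n./2 := ltn_ord q.1.
have hy : y q.2 < n.-1 by have /= := ltn_ord q.2; lia.
rewrite hx hy leq_addr eqxx /=.
apply: is_cycle_on_fcycle => //=.
- by rewrite !inE negb_or nxy nxt nyt.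
- by rewrite fx fy ft !eqxx.
- move=> z; rewrite !inE !negb_or => /and3P[zx zy zt].
  by rewrite permM !tpermD // 1?eq_sym.
Qed.

(** Relabelling each point by its position in the list of the points of S, then
    those of R, then v, sends K into T_2(n), and the two have the same size. *)
Lemma T2_isomorphic (K : {set 'S_n}) v (S R : {set 'I_n}) :
    {in K, forall s,
       [/\ #|moved s| = 3, v \in moved s, s v \in S & s (s v) \in R]} ->
    v \notin S -> v \notin R -> [disjoint S & R] ->
    #|S| = n./2 -> #|S| + #|R| = n.-1 -> #|T2 n| <= #|K| ->
  perm_isomorphic K (T2 n).
Proof.
move=> KP vS vR dis cS cSR cK.
pose l := enum S ++ enum R ++ [:: v].
have ul : uniq l.
  rewrite !cat_uniq !enum_uniq has_cat /= !mem_enum (negPf vR) (negPf vS) !orbF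
    !andbT.
  by apply/hasPn=> x; rewrite !mem_enum => xR; rewrite (disjointFl dis).
have sl : size l = n by rewrite !size_cat -!cardE addnA cSR /=; lia.
have ml x : x \in l.
  have sub : {subset l <= enum 'I_n} by move=> y _; rewrite mem_enum.
  have [|_ ->] := uniq_min_size ul sub; last by rewrite mem_enum.
  by rewrite size_enum_ord sl.
have ltl x : index x l < n by rewrite -[X in _ < X]sl index_mem.
pose p0 x := Ordinal (ltl x).
have p0_inj : injective p0.
  by move=> x y /(congr1 val) /= e; rewrite -(nth_index x (ml x)) e nth_index.
pose p := perm p0_inj.
have pS x : x \in S -> p x < n./2.
  by move=> xS; rewrite permE /= index_cat mem_enum xS -cS cardE index_mem
    mem_enum.
have pR x : x \in R -> n./2 <= p x < n.-1.
  move=> xR; rewrite permE /= index_cat mem_enum (disjointFl dis xR) -cardE cS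
    leq_addr.
  rewrite index_cat mem_enum xR -cSR cS ltn_add2l cardE index_mem mem_enum //.
have pv : p v = top.
  apply: val_inj; rewrite permE /= !index_cat !mem_enum (negPf vS) (negPf vR)
    /= eqxx.
  by rewrite -!cardE addn0.
exists p; apply/esym/eqP; rewrite eqEcard cardJg cK andbT.
apply/subsetP=> _ /imsetP[s sK ->]; have [s3 vs sS sR] := KP s sK.
apply/T2P; rewrite -pv !permJ movedJ card_imset; last exact: perm_inj.
by split; [|apply: pS|apply: pR].
Qed.

End Extremal.

Lemma nonstar_arith n : 10 <= n ->
  3 * n - 10 <= (n - 1) ^ 2 %/ 4 /\ (11 <= n -> 3 * n - 10 < (n - 1) ^ 2 %/ 4).
Proof.
move=> n10; have [k ->] : exists k, n = k + 10 by exists (n - 10); lia.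
have -> : k + 10 - 1 = k + 9 by lia.
by split=> [|k1]; rewrite leq_divRL // -mulnn; nia.
Qed.

Lemma T2_arith n : 10 <= n -> (n - 1) ^ 2 %/ 4 <= n./2 * (n.-1 - n./2).
Proof.
move=> n10; rewrite -ltnS ltn_divLR // -mulnn.
have [k [b [e -> b1]]] : exists k b, [/\ n = k.*2 + b, n./2 = k & b <= 1].
  exists n./2, (odd n : nat); rewrite addnC odd_double_half.
  by split=> //; case: (odd n).
have -> : n - 1 = k.*2 + b - 1 by lia.
have -> : n.-1 - k = k + b - 1 by lia.
have [j ej] : exists j, k = j.+1 by exists k.-1; lia.
rewrite ej; have -> : j.+1.*2 + b - 1 = j.*2 + b + 1 by lia.
have -> : j.+1 + b - 1 = j + b by lia.
by case: b {e} b1 => [|[|]] // _; nia.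
Qed.

(** * The clique number and the maximum cliques *)

Section Bound.
Variable T : finType.
Hypothesis n10 : 10 <= #|T|.
Implicit Types (F : {set {perm T}}) (v : T).

Lemma notin_sources_sinks F v : clique3 F -> {in F, forall s, v \in moved s} ->
  v \notin sources F v /\ v \notin sinks F v.
Proof.
move=> [F3 _ _] Fv; split; apply/negP => /imsetP[s sF e];
  have [] := moved3_orbit (F3 s sF) (Fv s sF); rewrite -e /= !inE eqxx ?orbT //.
Qed.

Lemma star_parts_le F v : clique3 F -> {in F, forall s, v \in moved s} ->
  #|sources F v :\: sinks F v| + #|sinks F v :\: sources F v|
  + #|sources F v :&: sinks F v| <= #|T| - 1.
Proof.
move=> Fc Fv; have [vS vR] := notin_sources_sinks Fc Fv.
have : #|sources F v :|: sinks F v| <= #|~: [set v]|.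
  apply: subset_leq_card; apply/subsetP=> x; rewrite !inE => xSR.
  by apply: contraTneq xSR => ->; rewrite negb_or vS.
rewrite cardsC1 -subn1.
have := cardsUI (sources F v) (sinks F v).
have := cardsID (sinks F v) (sources F v);
  have := cardsID (sources F v) (sinks F v).
rewrite (setIC (sinks F v)).
set a := #|_ :\: _|; set b := #|_ :\: _|; set c := #|_ :&: _|;
  set d := #|_ :|: _|.
by move: a b c d #|sources _ _| #|sinks _ _| #|T| => *; lia.
Qed.

Lemma clique3_card_le F : clique3 F -> #|F| <= (#|T| - 1) ^ 2 %/ 4.
Proof.
move=> Fc.
have [/existsP[v /eqP F0]|ns] := boolP [exists v, fixing F v == set0].
  have Fv : {in F, forall s, v \in moved s}.
    by move=> s sF; apply: contraT => vs; have := in_set0 s;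
      rewrite -F0 inE sF vs.
  apply: leq_trans (card_star_le Fc Fv) _.
  by have [] := star_arith _ (star_parts_le Fc Fv); first by lia.
have [le3 _] := nonstar_arith n10; apply: leq_trans le3.
apply: card_nonstar => // v; move: ns; rewrite negb_exists => /forallP; exact.
Qed.

Lemma extremal_star F : 11 <= #|T| -> clique3 F ->
    (#|T| - 1) ^ 2 %/ 4 <= #|F| ->
  exists v, [/\ {in F, forall s, v \in moved s},
    [disjoint sources F v & sinks F v],
    #|sources F v| + #|sinks F v| = #|T|.-1,
    #|sources F v| = #|T|./2 \/ #|sinks F v| = #|T|./2
    & odd #|T| -> #|sources F v| = #|T|./2].
Proof.
move=> n11 Fc Fge.
have [/existsP[v /eqP F0]|ns] := boolP [exists v, fixing F v == set0];
  last first.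
  have [_ /(_ n11) lt3] := nonstar_arith n10.
  move: Fge; rewrite leqNgt (leq_ltn_trans _ lt3) //.
  apply: card_nonstar => // v; move: ns; rewrite negb_exists => /forallP; exact.
have Fv : {in F, forall s, v \in moved s}.
  by move=> s sF; apply: contraT => vs; have := in_set0 s;
    rewrite -F0 inE sF vs.
have n9 : 9 <= #|T| - 1 by lia.
have parts := star_parts_le Fc Fv.
have le := leq_trans Fge (card_star_le Fc Fv).
have [_ /(_ le) d0] := star_arith n9 parts.
have SR0 : sources F v :&: sinks F v = set0 by apply/eqP; rewrite -cards_eq0 d0.
have SD : sources F v :\: sinks F v = sources F v.
  by apply/setDidPl; rewrite -setI_eq0 SR0.
have RD : sinks F v :\: sources F v = sinks F v.
  by apply/setDidPl; rewrite -setI_eq0 setIC SR0.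
rewrite SR0 cards0 SD RD ?addn0 ?add0n in le parts.
rewrite subn1 in parts.
have [e1 e2 e3] := balanced_arith n10 parts le.
by exists v; split=> //; rewrite -setI_eq0 SR0.
Qed.

End Bound.

Section Symmetric.
Variable n : nat.
Hypothesis n10 : 10 <= n.
Let cT : #|'I_n| = n := card_ord n.

Lemma card_T2 : #|T2 n| = (n - 1) ^ 2 %/ 4.
Proof.
apply/eqP; rewrite eqn_leq; apply/andP; split.
  by have := @clique3_card_le 'I_n; rewrite cT; apply => //; apply: T2_clique3.
exact: leq_trans (T2_arith n10) (card_T2_ge n10).
Qed.

Lemma clique_numberE :
  clique_number (kcycles n 3) (@birkhoff_adj n) = (n - 1) ^ 2 %/ 4.
Proof.
apply/eqP; rewrite eqn_leq; apply/andP; split.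
  apply/bigmax_leqP=> F /cliqueP Fc.
  by have := @clique3_card_le 'I_n; rewrite cT; apply.
rewrite -card_T2; apply: (@leq_bigmax_cond _ _ (fun F : {set 'S_n} => #|F|)).
by apply/cliqueP; apply: T2_clique3.
Qed.

Lemma is_max_cliqueP (K : {set 'S_n}) :
  reflect (clique3 K /\ #|K| = (n - 1) ^ 2 %/ 4)
          (is_max_clique (kcycles n 3) (@birkhoff_adj n) K).
Proof.
rewrite /is_max_clique clique_numberE.
by apply: (iffP andP) => [[/cliqueP ? /eqP ?]|[? ?]]; split=> //;
  [apply/cliqueP|apply/eqP].
Qed.

Lemma star_isomorphic (K : {set 'S_n}) v : clique3 K ->
    #|K| = (n - 1) ^ 2 %/ 4 ->
    {in K, forall s, v \in moved s} -> [disjoint sources K v & sinks K v] ->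
    #|sources K v| + #|sinks K v| = n.-1 -> #|sources K v| = n./2 ->
  perm_isomorphic K (T2 n).
Proof.
move=> Kc cK Kv dis cSR cS; have [vS vR] := notin_sources_sinks Kc Kv.
have [K3 _ _] := Kc.
apply: (T2_isomorphic n10 _ vS vR dis cS cSR); last by rewrite cK card_T2.
move=> s sK; split; [exact: K3|exact: Kv|exact: imset_f|].
exact: (imset_f (fun s : 'S_n => s (s v))).
Qed.

Lemma sources_sinksV (K : {set 'S_n}) v : clique3 K ->
    {in K, forall s, v \in moved s} ->
  sources (K^-1)%g v = sinks K v /\ sinks (K^-1)%g v = sources K v.
Proof.
move=> [K3 _ _] Kv.
have sV s : s \in K -> (s^-1)%g v = s (s v) /\ (s^-1)%g (s (s v)) = s v.
  move=> sK; have [_ s3 _] := moved3_orbit (K3 _ sK) (Kv _ sK).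
  by rewrite -[X in (s^-1)%g X = _]s3 !permK.
split; apply/setP=> x; apply/imsetP/imsetP => -[s sK ->].
- rewrite mem_invg in sK; exists (s^-1)%g => //.
  by have [_] := sV _ sK; have [<- _] := sV _ sK; rewrite invgK.
- by exists (s^-1)%g; rewrite ?mem_invg ?invgK //; have [->] := sV _ sK.
- rewrite mem_invg in sK; exists (s^-1)%g => //.
  by have [e1 e2] := sV _ sK; rewrite -e2 -e1 !invgK.
- by exists (s^-1)%g; rewrite ?mem_invg ?invgK //; have [-> ->] := sV _ sK.
Qed.

End Symmetric.

Unset Implicit Arguments.

Theorem theorem2p6 (n : nat) (hn : 10 <= n) :
  [/\ clique_number (kcycles n 3) (@birkhoff_adj n) = (n - 1) ^ 2 %/ 4,
      11 <= n -> odd n ->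
        is_max_clique (kcycles n 3) (@birkhoff_adj n) (T2 n) /\
        (forall K : {set 'S_n},
           is_max_clique (kcycles n 3) (@birkhoff_adj n) K ->
           perm_isomorphic K (T2 n))
    & 12 <= n -> ~~ odd n ->
        forall K : {set 'S_n},
          is_max_clique (kcycles n 3) (@birkhoff_adj n) K <->
          perm_isomorphic K (T2 n) \/ perm_isomorphic (K^-1)%g (T2 n)].
Proof.
have T2max := card_T2 hn; have T2c := T2_clique3 hn.
split; first exact: clique_numberE.
  move=> n11 on; split; first by apply/is_max_cliqueP.
  move=> K /(is_max_cliqueP hn)[Kc cK].
  have := @extremal_star 'I_n; rewrite card_ord => /(_ hn K n11 Kc).
  rewrite cK leqnn => /(_ isT)[v [Kv dis cSR _ /(_ on) cS]].
  exact: star_isomorphic cSR cS.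
move=> n12 _ K; split.
  move=> /(is_max_cliqueP hn)[Kc cK].
  have := @extremal_star 'I_n; rewrite card_ord => /(_ hn K (ltnW n12) Kc).
  rewrite cK leqnn => /(_ isT)[v [Kv dis cSR [cS|cR] _]].
    by left; apply: star_isomorphic cSR cS.
  right; have [eS eR] := sources_sinksV Kc Kv.
  apply: (star_isomorphic hn (v := v)); rewrite ?eS ?eR ?card_invg //.
  - exact: clique3V.
  - by move=> s; rewrite mem_invg -movedV; apply: Kv.
  - by rewrite disjoint_sym.
  - by rewrite addnC.
have T2K (L : {set 'S_n}) : perm_isomorphic L (T2 n) ->
    clique3 L /\ #|L| = (n - 1) ^ 2 %/ 4.
  case=> p eL; rewrite -T2max eL cardJg; split=> //.
  by rewrite -(conjsgK p L) -eL; apply: clique3J.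
case=> /T2K [Kc cK]; apply/(is_max_cliqueP hn); first by [].
by split; [rewrite -(invgK K); apply: clique3V | rewrite -card_invg].
Qed.
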